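(* (1) If $\mathcal{J}$ is a T-maximal ideal on $\mathbb{N}$, then $\mathcal{J}=t(\mathcal{I})$ for every maximal ideal $\mathcal{I}\supseteq\mathcal{J}$. (2) There is a maximal ideal $\mathcal{I}$ on $\mathbb{N}$ such that $t(\mathcal{I})$ is not a T-maximal ideal. (3) No T-maximal ideal has the Baire property.
   Context: For $A\subseteq\mathbb{N}$ and $k\in\mathbb{Z}$, $A+k$ denotes $\{a+k:a\in A\}\cap\mathbb{N}$. An ideal on $\mathbb{N}$ is a family $\mathcal{I}\subseteq\mathcal{P}(\mathbb{N})$ closed under finite unions and subsets, containing all finite subsets of $\mathbb{N}$, with $\mathbb{N}\notin\mathcal{I}$; it is maximal if it is not properly contained in another ideal on $\mathbb{N}$, and translation invariant if $A+k\in\mathcal{I}$ for all $A\in\mathcal{I}$, $k\in\mathbb{Z}$. A translation invariant ideal $\mathcal{I}$ is T-maximal if for every translation invariant ideal $\mathcal{J}$, $\mathcal{I}\subseteq\mathcal{J}$ implies $\mathcal{I}=\mathcal{J}$. For an ideal $\mathcal{I}$, $t(\mathcal{I})=\{A\subseteq\mathbb{N}:A+k\in\mathcal{I}\text{ for every }k\in\mathbb{Z}\}$. Subsets of $\mathbb{N}$ are identified with their characteristic functions, so $\mathcal{P}(\mathbb{N})$ carries the topology of the Cantor space $\{0,1\}^{\mathbb{N}}$; an ideal has the Baire property if it has the Baire property as a subset of this space. *)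

(* Defs.v *)
From mathcomp Require Import all_boot all_order all_algebra.
From mathcomp Require Import all_classical all_reals all_analysis.

Set Implicit Arguments.
Unset Strict Implicit.
Unset Printing Implicit Defensive.

Import GRing.Theory.
Local Open Scope classical_set_scope.
Local Open Scope ring_scope.

(* A + k is truncated: only the a + k that are natural numbers are kept. *)
Definition shift (A : set nat) (k : int) : set nat :=
  [set n | exists2 a : nat, A a & n%:Z = a%:Z + k].

Record ideal (I : set (set nat)) : Prop := Ideal {
  idealU : forall A B, I A -> I B -> I (A `|` B);
  idealS : forall A B, A `<=` B -> I B -> I A;
  ideal_fin : forall A, finite_set A -> I A;
  ideal_proper : ~ I [set: nat] }.

Definition maximal_ideal (I : set (set nat)) : Prop :=
  ideal I /\ ~ exists2 J, ideal J & I `<` J.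

Definition translation_invariant (I : set (set nat)) : Prop :=
  forall A (k : int), I A -> I (shift A k).

Definition T_maximal (I : set (set nat)) : Prop :=
  [/\ ideal I, translation_invariant I &
      forall J, ideal J -> translation_invariant J -> I `<=` J -> I = J].

Definition t (I : set (set nat)) : set (set nat) :=
  [set A | forall k : int, I (shift A k)].

Definition nowhere_dense (T : topologicalType) (A : set T) : Prop :=
  interior (closure A) = set0.

Definition meager (T : topologicalType) (A : set T) : Prop :=
  exists2 F : nat -> set T,
    (forall n, nowhere_dense (F n)) & A `<=` \bigcup_n F n.

Definition Baire_property (T : topologicalType) (A : set T) : Prop :=
  exists2 U : set T, open U & meager (A `+` U).

Definition char_fun (A : set nat) : cantor_space := fun n => n \in A.

(* Main.v *)
(** Write [fatten A m] for the set of numbers at distance at most [m] from [A].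
    If [J] is T-maximal and no complement of a [fatten A m] lies in [J], then
    [A] lies in [J]: otherwise [J] and the [fatten A m] generate a strictly
    larger translation invariant ideal.

    For (1), [t I] is a translation invariant ideal containing [J].  For (2),
    take a maximal ideal [I] containing the complement of the powers of 2: the
    gaps between powers of 2 tend to infinity, so a translate of the complement
    of [fatten powers2 m] contains almost all powers of 2 and is not in [I].
    For (3), an ideal with the Baire property is meager, and a meager ideal
    admits consecutive blocks of integers, of length tending to infinity, such
    that no set in the ideal contains infinitely many of them.  The union of
    every fourth block is then not in the ideal, and neither are the complements
    of its fattenings. *)

Require Import Defs.
From mathcomp Require Import all_boot all_order all_algebra.
From mathcomp Require Import all_classical all_reals all_analysis.
From mathcomp Require Import zify.

Set Implicit Arguments.
Unset Strict Implicit.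
Unset Printing Implicit Defensive.

Import GRing.Theory.
Local Open Scope classical_set_scope.

(* mathcomp-analysis also has a [shift], imported after the one of [Defs]. *)
Local Notation shift := Defs.shift.

(** * Cylinders as a neighbourhood basis of the Cantor space *)

Definition cylinder (N : nat) (x : cantor_space) : set cantor_space :=
  [set z | forall i, (i < N)%N -> z i = x i].

Lemma nbhs_cylinder N x : nbhs x (cylinder N x).
Proof.
have /(filter_forall _) : forall i : 'I_N,
    \forall z \near x, (z : nat -> bool) i = x i.
  move=> i.
  apply: (@proj_continuous nat (fun=> bool) i x [set x i]).
  exact: discrete_set1.
apply: filterS => z zx i iN; exact: (zx (Ordinal iN)).
Qed.

(** Otherwise points of [cylinder N x] outside [W], one for each [N], would converge to [x]. *)
Lemma cylinder_sub x (W : set cantor_space) : nbhs x W ->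
  exists N, cylinder N x `<=` W.
Proof.
move=> xW; apply: contrapT => nW.
have /choice[z zP] : forall N, exists z, cylinder N x z /\ ~ W z.
  move=> N; apply: contrapT => nz; apply: nW; exists N => z zx.
  by apply: contrapT => nWz; apply: nz; exists z.
have zx : z @ \oo --> x.
  apply/pointwise_cvgP => i B /nbhs_singleton Bxi.
  exists i.+1 => // N /= iN.
  by rewrite /= (zP N).1.
have [N _ /(_ N (leqnn _)) WN] := zx _ xW.
by case: (zP N).
Qed.

(** * Translations and the ideal [t I] *)

(** Only an inclusion: a negative [k] can drop points that [l] would have brought back. *)
Lemma shift_shift A (k l : int) : shift (shift A k) l `<=` shift A (k + l)%R.
Proof. by move=> n [b [a Aa bE] nE]; exists a => //; rewrite nE bE addrA. Qed.

Lemma shift0 A : shift A 0%R = A.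
Proof.
apply/seteqP; split => n; first by case=> a Aa; rewrite addr0 => -[->].
by move=> An; exists n => //; rewrite addr0.
Qed.

Lemma shiftS A B k : A `<=` B -> shift A k `<=` shift B k.
Proof. by move=> AB n [a /AB Ba nE]; exists a. Qed.

Lemma finite_shift A k : finite_set A -> finite_set (shift A k).
Proof.
move=> /(finite_image (fun a : nat => `|(a%:Z + k)%R|%N)).
apply: sub_finite_set.
by move=> n [a Aa nE]; exists a => //; rewrite -nE.
Qed.

Lemma ideal_t I : ideal I -> ideal (t I).
Proof.
move=> idI; split.
- move=> A B tA tB k; apply: (idealS idI) (idealU idI (tA k) (tB k)).
  by move=> n [a [Aa|Ba] nE]; [left|right]; exists a.
- move=> A B AB tB k; exact: (idealS idI (shiftS AB) (tB k)).
- by move=> A fA k; apply/(ideal_fin idI)/finite_shift.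
- by move=> /(_ 0%R); rewrite shift0; exact: ideal_proper.
Qed.

Lemma translation_invariant_t I : ideal I -> translation_invariant (t I).
Proof.
by move=> idI A k tA l; apply: (idealS idI) (@shift_shift _ _ _) (tA _).
Qed.

Lemma T_maximal_eq_t J I : T_maximal J -> ideal I -> J `<=` I -> J = t I.
Proof.
move=> [_ trJ maxJ] idI JI; apply: maxJ.
- exact: ideal_t.
- exact: translation_invariant_t.
- by move=> A JA k; apply/JI/trJ.
Qed.

(** * Fattenings and T-maximality *)

Definition fatten (A : set nat) (m : nat) : set nat :=
  [set n | exists2 a, A a & (n <= a + m)%N /\ (a <= n + m)%N].

Lemma fattenS A m n : (m <= n)%N -> fatten A m `<=` fatten A n.
Proof. by move=> mn x [a Aa [xa ax]]; exists a => //; lia. Qed.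

Lemma shift_fatten A m k : shift (fatten A m) k `<=` fatten A (m + `|k|%N).
Proof. by move=> n [b [a Aa [ba ab]] nE]; exists a => //; split; lia. Qed.

Lemma T_maximal_fatten J A : T_maximal J ->
  (forall m, ~ J (~` fatten A m)) -> J A.
Proof.
move=> [idJ trJ maxJ] nJ.
pose J' := [set B | exists C m, J C /\ B `<=` C `|` fatten A m].
suff -> : J = J'.
  exists set0, 0%N; split; first exact: ideal_fin.
  by move=> a Aa; right; exists a => //; lia.
apply: maxJ.
- split.
  + move=> B B' [C [m [JC BC]]] [C' [m' [JC' BC']]].
    exists (C `|` C'), (maxn m m'); split; first exact: idealU.
    move=> x [/BC|/BC'] [Cx|/fattenS mx].
    * by left; left.
    * by right; apply: mx; lia.
    * by left; right.
    * by right; apply: mx; lia.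
  + move=> B B' BB' [C [m [JC BC]]]; exists C, m; split => //.
    exact: subset_trans BC.
  + move=> B fB; exists B, 0%N; split; first exact: ideal_fin.
    by move=> x; left.
  + move=> [C [m [JC BC]]]; apply: (nJ m); apply: (idealS idJ) JC => x nx.
    by have [] := BC x I.
- move=> B k [C [m [JC BC]]]; exists (shift C k), (m + `|k|%N)%N.
  split; first exact: trJ.
  move=> x [b /BC[Cb|mb] xE]; first by left; exists b.
  by right; apply: shift_fatten; exists b.
- by move=> B JB; exists B, 0%N; split => // x; left.
Qed.

(** * A maximal ideal whose [t I] is not T-maximal *)

(** The dual ideal of an ultrafilter that extends the filter [F] of sets containing almost all of
    [A]. *)
Lemma maximal_idealC (A : set nat) : infinite_set A ->
  exists2 I, maximal_ideal I & I (~` A).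
Proof.
move=> infA; pose F := [set B | finite_set (A `\` B)].
have FF : ProperFilter F.
  split; first by rewrite /F /= setD0.
  split.
  - by rewrite /F /= setDT.
  - by move=> B C; rewrite /F /= setDIr finite_setU.
  - by move=> B C BC; apply: sub_finite_set; apply: setDS.
have [G [uG FG]] := ultraFilterLemma FF.
have pG : ProperFilter G := ultra_proper.
have GA : G A by apply: FG; rewrite /F /= setDv.
exists [set B | G (~` B)]; last by rewrite /= setCK.
split; first split.
- by move=> B C /= GB GC; rewrite setCU; exact: filterI.
- by move=> B C BC /=; apply: filterS; exact: subsetC.
- move=> B fB /=; apply: FG; rewrite /F /= setDE setCK.
  by apply: sub_finite_set fB => x [].
- by rewrite /= setCT; exact: filter_not_empty.
move=> [J idJ [/= IJ JI]]; apply: JI => B JB.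
have [GB|//] := in_ultra_setVsetC B uG.
have JcB : J (~` B) by apply: IJ; rewrite /= setCK.
by case: (ideal_proper idJ); rewrite -(setUv B); exact: idealU.
Qed.

Definition powers2 : set nat := range (fun i => 2 ^ i)%N.

Lemma infinite_powers2 : infinite_set powers2.
Proof.
have inj : injective (fun i => 2 ^ i)%N.
  by move=> i j /eqP; rewrite eqn_exp2l // => /eqP.
move=> /(finite_preimage (in2W inj)); rewrite preimage_range.
exact: infinite_nat.
Qed.

Lemma powers2_gap a b : powers2 a -> powers2 b -> (a < b)%N -> (2 * a <= b)%N.
Proof.
move=> [i _ <-] [j _ <-]; rewrite ltn_exp2l // => ij.
by rewrite -expnS leq_exp2l.
Qed.

Lemma powers2_sub_shift m :
  powers2 `<=` `I_(4 * m + 4) `|` shift (~` fatten powers2 m) (Posz m.+1).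
Proof.
move=> n An; have [nm|nm] := ltnP n (4 * m + 4); first by left.
right; exists (n - m.+1)%N; last by lia.
(* Here [a] is a power of 2 below [n], hence at most [n / 2], too far from [n - m.+1] once [n] is at
   least [4 * m + 4]. *)
move=> [a Aa [na an]].
have := powers2_gap Aa An; lia.
Qed.

Lemma exists_not_T_maximal_t :
  exists2 I, maximal_ideal I & ~ T_maximal (t I).
Proof.
have [I maxI IcA] := maximal_idealC infinite_powers2.
exists I => // TmaxI; have idI := maxI.1.
have nIA : ~ I powers2.
  move=> IA; apply: (ideal_proper idI).
  by rewrite -(setUv powers2); exact: idealU.
suff tA : t I powers2 by apply: nIA; rewrite -[powers2]shift0; exact: tA.
apply: T_maximal_fatten => // m /(_ (Posz m.+1)) Im.
apply: nIA; apply: (idealS idI) (@powers2_sub_shift m) _.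
by apply: idealU => //; exact: ideal_fin.
Qed.

(** * Nowhere dense and meager sets avoided by patterns on blocks *)

Lemma nowhere_dense_avoid (F : set cantor_space) N x : nowhere_dense F ->
  exists M y, [/\ (N <= M)%N, cylinder N x y & cylinder M y `&` F = set0].
Proof.
move=> F0; have [y xy ncFy] : exists2 y, cylinder N x y & ~ closure F y.
  apply: contrapT => ny; suff: interior (closure F) x by rewrite F0.
  apply: filterS (nbhs_cylinder N x) => y xy.
  by apply: contrapT => ncFy; apply: ny; exists y.
have [W yW WF] : exists2 W, nbhs y W & W `&` F = set0.
  apply: contrapT => nW; apply: ncFy => W yW.
  rewrite setIC; apply/set0P/eqP => WF.
  by apply: nW; exists W.
have [M MW] := cylinder_sub yW.
exists (maxn N M), y; split; [lia| by []|].
rewrite -subset0 -WF => z [yz Fz]; split => //.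
by apply: MW => i iM; apply: yz; lia.
Qed.

(** The pairs [(u p, F p)] are treated in turn: each lengthens the common pattern [s] to the right,
    which keeps what was avoided before. *)
Lemma nowhere_dense_avoid_seq (T : eqType) (u : T -> cantor_space)
    (F : T -> set cantor_space) N (L : seq T) :
  (forall p, nowhere_dense (F p)) ->
  exists M s, (N <= M)%N /\ forall p, p \in L -> forall z,
    cylinder N (u p) z -> (forall i, (N <= i < M)%N -> z i = s i) -> ~ F p z.
Proof.
move=> F0; elim: L => [|q L [M [s [NM sL]]]].
  by exists N, (fun=> false).
have [M' [y [MM' xy yF]]] :=
  nowhere_dense_avoid M (fun i => if (i < N)%N then u q i else s i) (F0 q).
exists M', y; split; first by lia.
move=> p; rewrite inE => /orP[/eqP-> z uz zy Fz|pL z pz zy].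
  suff: (cylinder M' y `&` F q) z by rewrite yF.
  split => // i iM'; have [iN|Ni] := ltnP i N; last by apply: zy; lia.
  by rewrite uz // xy ?iN//; lia.
apply: (sL p) => // i Ni; rewrite zy; last by lia.
by rewrite xy; [case: ifP => //; lia|lia].
Qed.

Lemma nowhere_dense_avoid_interval (F : nat -> set cantor_space) N k :
  (forall j, nowhere_dense (F j)) ->
  exists p : nat * cantor_space, (N + k < p.1)%N /\
    forall j z, (j <= k)%N -> (forall i, (N <= i < p.1)%N -> z i = p.2 i) ->
      ~ F j z.
Proof.
move=> F0.
(* Running over all prefixes of length [N] makes the pattern work whatever [z] is below [N]. *)
have [M [s [NM sL]]] := @nowhere_dense_avoid_seq (N.-tuple bool * 'I_k.+1)%type
  (fun p => nth false p.1) (fun p => F p.2) N (enum predT) (fun p => F0 p.2).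
exists (maxn M (N + k).+1, s); split => /=; first by lia.
move=> j z jk zs.
apply: (sL ([tuple z i | i < N], Ordinal (jk : (j < k.+1)%N))).
- by rewrite mem_enum.
- move=> i iN /=.
  by rewrite (nth_map (Ordinal iN)) ?size_enum_ord// nth_enum_ord.
- by move=> i Ni; apply: zs => /=; lia.
Qed.

Definition block (n : nat -> nat) (k : nat) : set nat :=
  [set i | (n k <= i < n k.+1)%N].

Section blocks.
Variable n : nat -> nat.
Hypothesis n_lt : forall k, (n k + k < n k.+1)%N.

Lemma block_start_le j k : (j <= k)%N -> (n j <= n k)%N.
Proof.
apply: (@homo_leq _ n (fun x y => is_true (x <= y)%N) leqnn leq_trans) => i.
by have := n_lt i; lia.
Qed.

Lemma block_inj i j k : block n j i -> block n k i -> j = k.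
Proof.
rewrite /block /= => ij ik.
by have [jk|kj|//] := ltngtP j k;
  [have := block_start_le jk|have := block_start_le kj]; lia.
Qed.

Lemma block_cover i : (n 0 <= i)%N -> exists k, block n k i.
Proof.
move=> n0i; have ex : exists k, (i < n k.+1)%N.
  by exists i; have := n_lt i; lia.
exists (ex_minn ex); case: ex_minnP => -[|k] ik kmin;
  rewrite /block /= ik andbT //.
by rewrite leqNgt; apply/negP => /kmin; lia.
Qed.

End blocks.

(* One half of Talagrand's characterization of meager subsets of the Cantor
   space. *)
Lemma meager_pattern (M : set cantor_space) : meager M ->
  exists (n : nat -> nat) (s : cantor_space),
    (forall k, (n k + k < n k.+1)%N) /\
    forall z : cantor_space,
      (forall K, exists2 k, (K <= k)%N & forall i, block n k i -> z i = s i) ->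
      ~ M z.
Proof.
move=> [F F0 MF].
have /choice[f fP] : forall Nk : nat * nat, exists p : nat * cantor_space,
    (Nk.1 + Nk.2 < p.1)%N /\ forall j z, (j <= Nk.2)%N ->
      (forall i, (Nk.1 <= i < p.1)%N -> z i = p.2 i) -> ~ F j z.
  by move=> [N k]; exact: nowhere_dense_avoid_interval.
pose n := fix n k := if k is k'.+1 then (f (n k', k')).1 else 0%N.
have n_lt k : (n k + k < n k.+1)%N by have [] := fP (n k, k).
(* As [n 0] is 0, the blocks partition the integers, and the patterns glue into one sequence. *)
have /choice[idx idxP] : forall i, exists k, block n k i.
  by move=> i; exact: block_cover.
exists n, (fun i => (f (n (idx i), idx i)).2 i); split => // z zs /MF[j _].
have [k jk zk] := zs j; have [_] := fP (n k, k); apply => //= i ik.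
by rewrite zk //; rewrite (block_inj n_lt (idxP i) ik).
Qed.

(** * Meager ideals and the Baire property *)

Lemma mem_char_fun (J : set (set nat)) (z : cantor_space) :
  (char_fun @` J) z <-> J [set i | z i].
Proof.
have inK : char_fun [set i | z i] = z.
  by apply/funext => i; apply/idP/idP; rewrite /char_fun inE.
split=> [[A JA <-]|Jz]; last by exists [set i | z i].
suff -> : [set i | char_fun A i] = A by [].
by apply/seteqP; split=> i; rewrite /= /char_fun inE.
Qed.

Lemma meager_ideal_block (J : set (set nat)) : ideal J ->
  meager (char_fun @` J) ->
  exists n : nat -> nat, (forall k, (n k + k < n k.+1)%N) /\
    forall A, (forall K, exists2 k, (K <= k)%N & block n k `<=` A) -> ~ J A.
Proof.
move=> idJ /meager_pattern[n [s [n_lt sP]]]; exists n; split => // A blockA JA.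
(* This subset of [A] follows [s] on every block inside [A]. *)
apply: (sP (fun i => (i \in A) && s i)) => [K|].
  have [k Kk kA] := blockA K; exists k => // i /kA Ai.
  by rewrite mem_set.
apply/mem_char_fun; apply: (idealS idJ) JA => i /= /andP[].
by rewrite inE.
Qed.

Lemma T_maximal_not_meager (J : set (set nat)) : T_maximal J ->
  ~ meager (char_fun @` J).
Proof.
move=> TJ; have [idJ _ _] := TJ.
move=> /(meager_ideal_block idJ)[n [n_lt nP]].
pose A := [set i | exists k, block n (4 * k) i].
have nJA : ~ J A.
  by apply: nP => K; exists (4 * K)%N; [lia|move=> i iK; exists K].
apply: nJA; apply: T_maximal_fatten => // m; apply: nP => K.
(* This block is separated from [A] on each side by a whole block, of length greater than [m]. *)
exists (4 * (K + m) + 2)%N; first by lia.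
move=> x; rewrite /block /= => xk [a [k ak] [xa ax]].
set l := (K + m)%N in xk.
have lm : (m <= l)%N by lia.
have [kl|lk] := leqP k l.
  have le_n : (n (4 * k).+1 <= n (4 * l).+1)%N.
    by apply: block_start_le => //; lia.
  have := n_lt (4 * l).+1; rewrite (_ : (4 * l).+2 = 4 * l + 2)%N; last by lia.
  by move: ak; rewrite /block /=; lia.
have le_n : (n (4 * l + 2).+2 <= n (4 * k))%N.
  by apply: block_start_le => //; lia.
by have := n_lt (4 * l + 2).+1; move: ak; rewrite /block /=; lia.
Qed.

(* An ideal is never comeager in a nonempty open set, because
   it would then contain two sets whose union is cofinite. *)
Lemma ideal_Baire_meager (J : set (set nat)) : ideal J ->
  Baire_property (char_fun @` J) -> meager (char_fun @` J).
Proof.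
move=> idJ [U oU mU].
have [U0|/set0P[u Uu]] := eqVneq U set0.
  by move: mU; rewrite U0 setY0.
exfalso.
have [N uN] := cylinder_sub (open_nbhs_nbhs (conj oU Uu)).
have [n [s [n_lt sP]]] := meager_pattern mU.
(* Such a [z] lies in [U] and avoids the meager symmetric difference. *)
have inJ (z : cantor_space) : cylinder N u z ->
    (forall K, exists2 k, (K <= k)%N & forall i, block n k i -> z i = s i) ->
    J [set i | z i].
  move=> uz zs; apply/mem_char_fun; apply: contrapT => nJz.
  by apply: (sP z zs); right; split => //; exact: uN.
pose E := [set i | exists k, block n (2 * k) i].
(* From [N] on, [z1] follows [s] on even blocks and is true on odd ones; [z2] does the reverse. *)
pose z1 : cantor_space := fun i => if (i < N)%N then u i else (i \in E) ==> s i.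
pose z2 : cantor_space := fun i => if (i < N)%N then u i else (i \in E) || s i.
have n_ge k : (k <= n k)%N by elim: k => // k; have := n_lt k; lia.
have J1 : J [set i | z1 i].
  apply: inJ => [i iN|K]; first by rewrite /z1 iN.
  (* Adding [N] makes the block start past the prefix copied from [u]. *)
  exists (2 * (K + N))%N; first by lia.
  move=> i ik; rewrite /z1 ltnNge (leq_trans _ (proj1 (andP ik)))/=; last first.
    by have := n_ge (2 * (K + N))%N; lia.
  by rewrite mem_set//; exists (K + N)%N.
have J2 : J [set i | z2 i].
  apply: inJ => [i iN|K]; first by rewrite /z2 iN.
  exists (2 * (K + N)).+1; first by lia.
  move=> i ik; rewrite /z2 ltnNge (leq_trans _ (proj1 (andP ik)))/=; last first.
    by have := n_ge (2 * (K + N)).+1; lia.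
  rewrite memNset// => -[k ik']; have := block_inj n_lt ik ik'; lia.
apply: (ideal_proper idJ).
apply: (idealS idJ) (idealU idJ _ (idealU idJ J1 J2)); last first.
  exact: (ideal_fin idJ (finite_II N)).
move=> i _; have [iN|Ni] := ltnP i N; first by left.
right; rewrite /z1 /z2 /setU /= ltnNge Ni /=.
by case: (i \in E) => /=; [right|left].
Qed.

Theorem theorem3p13 :
  [/\ (forall J : set (set nat), T_maximal J ->
         forall I : set (set nat), maximal_ideal I -> J `<=` I -> J = t I),
      (exists2 I : set (set nat), maximal_ideal I & ~ T_maximal (t I)) &
      (forall J : set (set nat), T_maximal J ->
         ~ Baire_property (char_fun @` J))].
Proof.
split; first by move=> J TJ I [idI _]; exact: T_maximal_eq_t.
  exact: exists_not_T_maximal_t.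
move=> J TJ; have [idJ _ _] := TJ.
by move=> /(ideal_Baire_meager idJ); exact: T_maximal_not_meager.
Qed.
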